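(* Let $n\ge2$ be an integer and $a,b,c\in2\mathbb N$. With $f$ as below, $$f(a,b,c,0)=\frac{(n-2)!\,(n-2)!!}{P_{n-1}}\cdot\frac{F_0}{F_{n-2}},$$ where $F_k=F_k(a,b,c,0)$ and $P_k=P_k(a,b,c,0)$; explicitly, $$f(a,b,c,0)=\frac{(n-2)!\,a!!\,b!!\,c!!}{(a+n-2)!!\,(b+n-2)!!\,(c+n-2)!!\,(a+b+c+n-1)!!}.$$
   Context: $f(a,b,c,d)=I_n\begin{pmatrix}a&c\\ b&d\end{pmatrix}/\big((a+d+n-2)!!\,(b+c+n-2)!!\big)$, where $I_n\begin{pmatrix}a&c\\ b&d\end{pmatrix}=\int_{O_n}u_{11}^a u_{12}^c u_{21}^b u_{22}^d\,du$ (Haar probability measure). $F_k(a,b,c,d)=(a+k)!!(b+k)!!(c+k)!!(d+k)!!$ and $P_k(a,b,c,d)=(a+b+c+d+k)!!$. Double factorial convention: for an integer $m\ge0$, $m!!=(m-1)(m-3)\cdots$, the product of the positive integers $\le m-1$ of the parity of $m-1$ (empty product $=1$); $(n-2)!$ is the ordinary factorial. *)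

(* Defs.v *)
From HB Require Import structures.
From mathcomp Require Import all_boot all_order all_algebra.
From mathcomp Require Import all_classical all_reals all_analysis.
Set Implicit Arguments. Unset Strict Implicit. Unset Printing Implicit Defensive.
Import Order.TTheory GRing.Theory Num.Theory.
Import numFieldNormedType.Exports.
Local Open Scope classical_set_scope.
Local Open Scope ring_scope.

Fixpoint df (k : nat) : nat :=
  match k with
  | 0 => 1
  | 1 => 1
  | k'.+2 => (k'.+2 * df k')%N
  end.

(* The paper's double factorial:  m!! = (m-1)(m-3)..., i.e. the ordinary
   double factorial of m-1 (empty product = 1 for m = 0). *)
Definition pdf (m : nat) : nat := df m.-1.

Definition Fk (k a b c d : nat) : nat :=
  (pdf (a + k) * pdf (b + k) * pdf (c + k) * pdf (d + k))%N.
Definition Pk (k a b c d : nat) : nat := pdf (a + b + c + d + k).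

Section Haar.
Variables (R : realType) (n : nat).

(* Borel sigma-algebra on n x n real matrices, generated by the entry maps
   (= the Borel sigma-algebra of R^(n*n)). *)
Definition mx_gen : set (set 'M[R]_n) :=
  [set A | exists i j, exists2 B : set R, measurable B &
     A = (fun M : 'M[R]_n => M i j) @^-1` B].

Local Notation MX := (g_sigma_algebraType mx_gen).

Definition On : set MX := [set M : 'M[R]_n | M *m M^T = 1%:M].

(* mu is the Haar probability measure of O_n: a probability measure on
   matrices, carried by O_n and invariant under left multiplication by
   orthogonal matrices (on the compact group O_n this characterizes the Haar
   probability measure uniquely). *)
Definition is_haar_On (mu : probability MX R) : Prop :=
  mu On = 1%E /\
  forall Q : 'M[R]_n, Q *m Q^T = 1%:M ->
    forall A : set MX, measurable A ->
      mu ((fun M : MX => (Q *m M : MX)) @^-1` A) = mu A.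

End Haar.

Notation MX R n := (g_sigma_algebraType (@mx_gen R n)).

Lemma ord0_lt (n : nat) : (2 <= n)%N -> (0 < n)%N.
Proof. by move=> h; apply: leq_trans h. Qed.

Definition oi0 (n : nat) (hn : (2 <= n)%N) : 'I_n := Ordinal (ord0_lt hn).
Definition oi1 (n : nat) (hn : (2 <= n)%N) : 'I_n := Ordinal hn.

Definition In_int (R : realType) (n : nat) (hn : (2 <= n)%N)
    (mu : probability (MX R n) R) (a b c d : nat) : R :=
  (\int[mu]_(M in [set: MX R n])
     ((M : 'M[R]_n) (oi0 hn) (oi0 hn) ^+ a * (M : 'M[R]_n) (oi0 hn) (oi1 hn) ^+ c *
      (M : 'M[R]_n) (oi1 hn) (oi0 hn) ^+ b * (M : 'M[R]_n) (oi1 hn) (oi1 hn) ^+ d))%R.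

Definition f_In (R : realType) (n : nat) (hn : (2 <= n)%N)
    (mu : probability (MX R n) R) (a b c d : nat) : R :=
  In_int hn mu a b c d /
    ((pdf (a + d + n - 2))%:R * (pdf (b + c + n - 2))%:R).

(* Main.v *)
(* For rows i != j let L_ij be the infinitesimal rotation of the plane (i, j),
   acting on polynomials in the entries.  Invariance of the Haar measure gives
   E (L_ij f) = 0.  Summing E (L_ij (M j k * g)) = 0 over j and using that the
   columns of an orthogonal matrix are orthonormal yields recurrences between
   the moments I(a, b, c) = E (M 0 0 ^ a * M 1 0 ^ b * M 0 1 ^ c):
     (a + b + c + n) I(a + 2, b, c) = (a + 1) I(a, b, c),
     (b + n - 1) (b + c + n) I(0, b + 2, c) = (b + 1) (b + c + n - 1) I(0, b, c),
     (c + n) I(0, 0, c + 2) = (c + 1) I(0, 0, c),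
   and I(0, 0, 0) = 1.  For the second one, the extra moment
   c E (x1 * x2 ^ (b + 1) * y1 ^ (c - 1) * y2), where x and y are the first two
   columns, is eliminated with E (L_12 (x1 * x2 ^ (b + 1) * y1 ^ c)) = 0. *)
Require Import Defs.
From HB Require Import structures.
From mathcomp Require Import all_boot all_order all_algebra.
From mathcomp Require Import all_classical all_reals all_analysis.
From mathcomp Require Import measurable_realfun.
From mathcomp Require Import ring lra.
Set Implicit Arguments. Unset Strict Implicit. Unset Printing Implicit Defensive.
Import Order.TTheory GRing.Theory Num.Theory.
Import numFieldNormedType.Exports.
Local Open Scope ring_scope.
Local Open Scope classical_set_scope.

(** * Measurability and column relations on the orthogonal group *)

Lemma measurable_entry (R : realType) n (i j : 'I_n) :
  measurable_fun [set: MX R n] (fun M : MX R n => (M : 'M[R]_n) i j).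
Proof.
move=> _ B mB; rewrite setTI; apply: sub_sigma_algebra.
by exists i, j, B.
Qed.

Lemma measurable_mulmx (R : realType) n (Q : 'M[R]_n) :
  measurable_fun [set: MX R n] (fun M : MX R n => (Q *m (M : 'M[R]_n)) : MX R n).
Proof.
apply: (@measurability _ _ (MX R n) (MX R n) setT
  (fun M => Q *m (M : 'M[R]_n)) (@mx_gen R n)) => //.
move=> _ [_ [i [j [B mB ->]]] <-].
have mf : measurable_fun [set: MX R n] (fun M : MX R n => (Q *m (M : 'M[R]_n)) i j).
  under eq_fun do rewrite mxE.
  apply: measurable_sum => k.
  by apply: measurable_funM => //; exact: measurable_entry.
exact: mf.
Qed.

Lemma measurable_On (R : realType) n : measurable (@On R n).
Proof.
have -> : @On R n = \bigcap_(p in [set: 'I_n * 'I_n])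
    ([set: MX R n] `&` (fun M : MX R n => ((M : 'M[R]_n) *m (M : 'M[R]_n)^T) p.1 p.2)
      @^-1` [set (1%:M : 'M[R]_n) p.1 p.2]).
  apply/seteqP; split => [M MO p _|M MO]; first by split => //=; rewrite MO.
  by apply/matrixP => i j; have [] := MO (i, j) Logic.I.
apply: fin_bigcap_measurable => // -[i j] _ /=.
suff mf : measurable_fun [set: MX R n] (fun M : MX R n => ((M : 'M[R]_n) *m (M : 'M[R]_n)^T) i j).
  exact: mf.
under eq_fun do rewrite mxE.
apply: measurable_sum => k; under eq_fun do rewrite mxE.
by apply: measurable_funM; exact: measurable_entry.
Qed.

Lemma On_mulmx {R : realType} {n} (Q M : 'M[R]_n) : On Q -> On M -> On (Q *m M).
Proof.
rewrite /On /= => hQ hM.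
by rewrite trmx_mul mulmxA -(mulmxA Q) hM mulmx1.
Qed.

(** [On] says that the rows are orthonormal; a one-sided inverse of a square matrix is two-sided, so
    the columns are orthonormal too. *)
Lemma On_colP {R : realType} {n} (M : 'M[R]_n) (k l : 'I_n) : On M ->
  \sum_i M i k * M i l = (k == l)%:R.
Proof.
move=> /mulmx1C /matrixP/(_ k l); rewrite !mxE => <-.
by apply: eq_bigr => i _; rewrite mxE.
Qed.

Lemma On_le1 {R : realType} {n} (M : 'M[R]_n) (i k : 'I_n) : On M -> `|M i k| <= 1.
Proof.
move=> /(On_colP k k); rewrite eqxx (bigD1 i) //= => h.
rewrite -(@expr_le1 _ 2) // real_normK ?num_real // expr2 -[1]/(1 *+ true) -h lerDl.
by apply: sumr_ge0 => j _; rewrite -expr2 sqr_ge0.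
Qed.

(** * Plane rotations and first-order expansions along them *)

Section Rotation.
Context {R : realType} {n : nat}.
Implicit Types (i j k l : 'I_n) (s : R) (M : 'M[R]_n) (f g h : MX R n -> R).

(** For [i != j], [skew_mx] generates the rotations of the plane of coordinates [i] and [j], and
    [plane_mx] is the orthogonal projection onto that plane. *)
Definition skew_mx i j : 'M[R]_n := delta_mx i j - delta_mx j i.
Definition plane_mx i j : 'M[R]_n := delta_mx i i + delta_mx j j.

Lemma delta_mulmxE i j M k l : (delta_mx i j *m M) k l = (k == i)%:R * M j l.
Proof.
rewrite mxE (bigD1 j) //= mxE eqxx andbT big1 ?addr0 // => m /negPf mj.
by rewrite mxE mj andbF mul0r.
Qed.

Lemma skew_mxE i j M k l :
  (skew_mx i j *m M) k l = (k == i)%:R * M j l - (k == j)%:R * M i l.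
Proof. by rewrite mulmxBl -!delta_mulmxE !mxE. Qed.

Lemma plane_mxE i j M k l :
  (plane_mx i j *m M) k l = (k == i)%:R * M i l + (k == j)%:R * M j l.
Proof. by rewrite mulmxDl -!delta_mulmxE !mxE. Qed.

(* The rotation by the angle [asin s] in the plane [(i, j)]. *)
Definition rot_mx i j s : 'M[R]_n :=
  1%:M + s *: skew_mx i j - (1 - Num.sqrt (1 - s ^+ 2)) *: plane_mx i j.

Lemma rot_mxE i j s M k l : (rot_mx i j s *m M) k l =
  M k l + s * (skew_mx i j *m M) k l
    - (1 - Num.sqrt (1 - s ^+ 2)) * (plane_mx i j *m M) k l.
Proof. by rewrite mulmxBl mulmxDl mul1mx -!scalemxAl !mxE. Qed.

(** With [K] for [skew_mx i j] and [P] for [plane_mx i j], the relations [KK = -P], [KP = PK = K]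
    and [PP = P] reduce the product to [1 + (s^2 - 2e + e^2) P], whose coefficient vanishes for
    [e = 1 - sqrt (1 - s^2)]. *)
Lemma On_rot i j s : i != j -> 0 <= s <= 1 -> On (rot_mx i j s).
Proof.
move=> ij /andP[s0 s1]; rewrite /On /= /rot_mx.
set e := 1 - Num.sqrt _.
have he : s ^+ 2 - 2 * e + e ^+ 2 = 0.
  have : Num.sqrt (1 - s ^+ 2) ^+ 2 = 1 - s ^+ 2.
    by rewrite sqr_sqrtr // subr_ge0 expr_le1.
  by rewrite /e; move: (Num.sqrt _) => c hc; nra.
have KT : (skew_mx i j)^T = - skew_mx i j.
  by rewrite /skew_mx linearB /= !trmx_delta opprB.
have PT : (plane_mx i j)^T = plane_mx i j.
  by rewrite /plane_mx linearD /= !trmx_delta.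
have ji : (j == i) = false by rewrite eq_sym (negPf ij).
have KK : skew_mx i j *m skew_mx i j = - plane_mx i j.
  rewrite /skew_mx /plane_mx !(mulmxBl, mulmxBr) !mul_delta_mx_cond.
  by rewrite !eqxx ji (negPf ij) !mulr1n !mulr0n
    !(addr0, add0r, subr0, sub0r) opprD.
have KP : skew_mx i j *m plane_mx i j = skew_mx i j.
  rewrite /skew_mx /plane_mx !(mulmxBl, mulmxDr) !mul_delta_mx_cond.
  by rewrite !eqxx ji (negPf ij) !mulr1n !mulr0n
    !(addr0, add0r, subr0, sub0r) addrC.
have PK : plane_mx i j *m skew_mx i j = skew_mx i j.
  rewrite /skew_mx /plane_mx !(mulmxDl, mulmxBr) !mul_delta_mx_cond.
  by rewrite !eqxx ji (negPf ij) !mulr1n !mulr0n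
    !(addr0, add0r, subr0, sub0r).
have PP : plane_mx i j *m plane_mx i j = plane_mx i j.
  rewrite /plane_mx !(mulmxDl, mulmxDr) !mul_delta_mx_cond.
  by rewrite !eqxx ji (negPf ij) !mulr1n !mulr0n
    !(addr0, add0r, subr0, sub0r).
have tE : (1%:M + s *: skew_mx i j - e *: plane_mx i j)^T =
    1%:M - s *: skew_mx i j - e *: plane_mx i j.
  by rewrite -[in RHS]scalerN -KT -[in RHS]PT -!linearZ /= -(@trmx1 R n) -linearD -linearB trmx1.
rewrite tE.
rewrite mulmxBl mulmxDl !mulmxBr !mul1mx !mulmx1.
rewrite -!scalemxAl -!scalemxAr KK KP PK PP.
apply/matrixP => k l; rewrite !mxE.
move: (k == l) => a; move: ((k == i) && (l == j)) => b1.
move: ((k == j) && (l == i)) ((k == i) && (l == i)) ((k == j) && (l == j)) => b2 b3 b4.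
(* [b3%:R + b4%:R] is the entry of [plane_mx i j]; [he] turns a zero multiple of it into the missing
   term. *)
rewrite -[RHS]addr0 -(mul0r (b3%:R + b4%:R)) -he.
ring.
Qed.

(** The bound is asked on O_n only, since even the entries are unbounded on the space of all
    matrices. *)
Definition bounded_On f := measurable_fun [set: MX R n] f /\
  exists2 C, 0 <= C & forall M, On M -> `|f M| <= C.

(* [g] is the derivative of [f] along the infinitesimal rotation of rows [i] and
   [j]; the quadratic error bound avoids differentiating under the integral. *)
Definition lie i j f g := [/\ bounded_On f, bounded_On g &
  exists2 C, 0 <= C & forall M s, On M -> 0 <= s <= 1 ->
    `|f (rot_mx i j s *m M) - f M - s * g M| <= C * s ^+ 2].

Lemma bounded_On_entry k l : bounded_On (fun M => (M : 'M[R]_n) k l).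
Proof.
split; first exact: measurable_entry.
by exists 1 => // M; exact: On_le1.
Qed.

Lemma bounded_On_cst (c : R) : bounded_On (fun=> c).
Proof. by split => //; exists `|c|. Qed.

Lemma bounded_OnD f g : bounded_On f -> bounded_On g ->
  bounded_On (fun M => f M + g M).
Proof.
move=> [mf [C C0 fC]] [mg [D D0 gD]]; split; first exact: measurable_funD.
exists (C + D); first exact: addr_ge0.
by move=> M MO; rewrite (le_trans (ler_normD _ _)) // lerD ?fC ?gD.
Qed.

Lemma bounded_OnM f g : bounded_On f -> bounded_On g ->
  bounded_On (fun M => f M * g M).
Proof.
move=> [mf [C C0 fC]] [mg [D D0 gD]]; split; first exact: measurable_funM.
exists (C * D); first exact: mulr_ge0.
by move=> M MO; rewrite normrM ler_pM ?fC ?gD.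
Qed.

Lemma bounded_OnN f : bounded_On f -> bounded_On (fun M => - f M).
Proof.
move=> bf; have := bounded_OnM (bounded_On_cst (-1)) bf.
by under eq_fun do rewrite mulN1r.
Qed.

Lemma bounded_On_sum (I : Type) (r : seq I) (F : I -> MX R n -> R) :
  (forall m, bounded_On (F m)) -> bounded_On (fun M => \sum_(m <- r) F m M).
Proof.
move=> bF; elim: r => [|m r ih].
  by under eq_fun do rewrite big_nil; exact: bounded_On_cst.
by under eq_fun do rewrite big_cons; exact: bounded_OnD.
Qed.

Lemma bounded_On_skew i j k l :
  bounded_On (fun M => (skew_mx i j *m (M : 'M[R]_n)) k l).
Proof.
under eq_fun do rewrite mxE; apply: bounded_On_sum => m.
by apply: bounded_OnM; [exact: bounded_On_cst|exact: bounded_On_entry].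
Qed.

(** The remainder is exactly [- e * (plane_mx i j *m M) k l] with [0 <= e <= s ^+ 2]; the last
    factor involves at most two entries of [M], whence the constant 2. *)
Lemma lie_entry i j k l : lie i j (fun M => (M : 'M[R]_n) k l)
  (fun M => (skew_mx i j *m (M : 'M[R]_n)) k l).
Proof.
split; [exact: bounded_On_entry|exact: bounded_On_skew|].
exists 2 => // M s MO /andP[s0 s1]; rewrite rot_mxE.
set e := 1 - _.
have /andP[e0 es] : 0 <= e <= s ^+ 2.
  have c0 : 0 <= Num.sqrt (1 - s ^+ 2) := sqrtr_ge0 _.
  have : Num.sqrt (1 - s ^+ 2) ^+ 2 = 1 - s ^+ 2.
    by rewrite sqr_sqrtr // subr_ge0 expr_le1.
  rewrite /e; move: (Num.sqrt _) c0 => c c0 hc.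
  have c1 : c <= 1 by nra.
  (* As [0 <= c <= 1], [1 - c <= (1 - c) * (1 + c) = s ^+ 2]. *)
  by apply/andP; split; nra.
rewrite [X in `|X|](_ : _ = - (e * (plane_mx i j *m M) k l)); last by ring.
rewrite normrN normrM (ger0_norm e0) mulrC ler_pM //.
rewrite plane_mxE (le_trans (ler_normD _ _)) //.
rewrite -[2]/(1 + 1) lerD // normrM.
  by rewrite mulr_ile1 ?On_le1 // normr_nat; case: (k == i).
by rewrite mulr_ile1 ?On_le1 // normr_nat; case: (k == j).
Qed.

Lemma lie_cst i j (c : R) : lie i j (fun=> c) (fun=> 0).
Proof.
split; [exact: bounded_On_cst|exact: bounded_On_cst|].
by exists 0 => // M s _ _; rewrite subrr mulr0 subr0 normr0 mul0r.
Qed.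

(** Leibniz rule: the remainder splits into that of [f] times the rotated [g], the first-order
    expansion of [f] times the remainder of [g], and [s ^+ 2 * (f' * g')]. The three terms of the
    constant bound these in turn. *)
Lemma lieM i j f f' g g' : i != j -> lie i j f f' -> lie i j g g' ->
  lie i j (fun M => f M * g M) (fun M => f' M * g M + f M * g' M).
Proof.
move=> ij [bf bf' [C C0 hf]] [bg bg' [D D0 hg]]; split.
- exact: bounded_OnM.
- by apply: bounded_OnD; exact: bounded_OnM.
have [_ [A A0 fA]] := bf; have [_ [A' A'0 fA']] := bf'.
have [_ [B B0 gB]] := bg; have [_ [B' B'0 gB']] := bg'.
exists (C * B + (A + A') * D + A' * B').
  by rewrite !(addr_ge0, mulr_ge0).
move=> M s MO s01; have RO := On_mulmx (On_rot ij s01) MO.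
have /andP[s0 s1] := s01.
move: (hf _ _ MO s01) (hg _ _ MO s01) (fA _ MO) (fA' _ MO) (gB' _ MO) (gB _ RO).
move: (f _) (g _) (f M) (f' M) (g M) (g' M) => F G x x' y y' hF hG hx hx' hy' hGB.
rewrite [X in `|X|](_ : _ = (F - x - s * x') * G + (x + s * x') * (G - y - s * y')
   + s ^+ 2 * (x' * y')); last by ring.
rewrite [leRHS]mulrDl (le_trans (ler_normD _ _)) // lerD //.
  rewrite [leRHS]mulrDl (le_trans (ler_normD _ _)) // lerD // normrM.
    by rewrite mulrAC ler_pM.
  rewrite -mulrA ler_pM // (le_trans (ler_normD _ _)) // lerD // normrM.
  by rewrite (ger0_norm s0) -[A']mul1r ler_pM.
by rewrite normrM normrX (ger0_norm s0) mulrC normrM ler_wpM2r ?sqr_ge0 ?ler_pM.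
Qed.

Lemma lie_ext i j f g h : (forall M, g M = h M) -> lie i j f g -> lie i j f h.
Proof. by move=> /funext ->. Qed.

Lemma lieX i j f g m : i != j -> lie i j f g ->
  lie i j (fun M => f M ^+ m) (fun M => m%:R * f M ^+ m.-1 * g M).
Proof.
move=> ij fg; elim: m => [|m ih].
  (* For [m = 0] the coefficient is zero, so the truncated exponent [m.-1] does no harm. *)
  under [X in lie _ _ _ X]eq_fun do rewrite !mul0r.
  exact: lie_cst.
under [X in lie _ _ X]eq_fun do rewrite exprS.
apply: lie_ext (lieM ij fg ih) => M /=.
by case: m {ih} => [|m] /=; rewrite ?exprS -?natr1; ring.
Qed.

End Rotation.

(** * Haar integrals and integration by parts *)

Section HaarIntegral.
Context {R : realType} {n : nat} (mu : probability (MX R n) R).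
Hypothesis Hmu : is_haar_On mu.
Implicit Types (i j k l : 'I_n) (s : R) (M : 'M[R]_n) (f g h : MX R n -> R).

Local Notation On := (@On R n).
Local Notation "''E' f" := (Rintegral mu On f) (at level 10, f at level 8).

Lemma bounded_On_integrable f : bounded_On f -> mu.-integrable On (EFin \o f).
Proof.
move=> [mf [C C0 fC]]; apply: measurable_bounded_integrable.
- exact: measurable_On.
- by apply: (le_lt_trans (probability_le1 mu _)) (ltry _); exact: measurable_On.
- exact: measurable_funTS.
- by exists C; split => [|x Cx M MO]; [exact: num_real|exact: (le_trans (fC _ MO) (ltW Cx))].
Qed.

(** Links [In_int], an integral over all matrices, to integrals over O_n: the complement of O_n is
    null. *)
Lemma Rintegral_On f : measurable_fun setT f ->
  \int[mu]_(M in setT) f M = 'E f.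
Proof.
move=> mf; rewrite [RHS]Rintegral_mkcond /Rintegral; congr fine.
have mO := @measurable_On R n.
apply: ae_eq_integral => //.
- exact/measurable_EFinP.
- apply/measurable_EFinP; apply/(measurable_restrictT _ mO).
  exact: measurable_funTS.
exists (~` On); split; first exact: measurableC.
  transitivity (1 - mu On)%E; first exact: probability_setC.
  by case: Hmu => -> _; rewrite subee.
move=> M /= h MO; apply: h => _.
by rewrite patchE mem_set.
Qed.

(** Left multiplication by [Q] preserves [mu] and pulls O_n back to itself, so this is the change of
    variables for a pushforward. *)
Lemma Rintegral_On_mulmx f (Q : 'M[R]_n) : bounded_On f -> On Q ->
  'E (fun M => f (Q *m M)) = 'E f.
Proof.
move=> bf QO; have mO := @measurable_On R n.
have imO : (fun M : MX R n => (Q *m M : MX R n)) @^-1` On = On.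
  apply/seteqP; split => M /= MO; last exact: On_mulmx.
  have QT : On Q^T by rewrite /Defs.On /= trmxK; exact: mulmx1C.
  by have := On_mulmx QT MO; rewrite mulmxA (mulmx1C QO) mul1mx.
have bfQ : bounded_On (fun M => f (Q *m M)).
  case: bf => mf [C C0 fC]; split.
    exact: (measurableT_comp mf (measurable_mulmx Q)).
  by exists C => // M MO; apply: fC; exact: On_mulmx.
have mQ := measurable_mulmx Q.
rewrite /Rintegral; congr fine; rewrite -[in LHS]imO.
rewrite -(integral_pushforward mQ (f := EFin \o f)) //.
- by apply: eq_measure_integral => A mA _; exact: Hmu.2.
- by apply/measurable_EFinP; case: bf.
- by rewrite imO; exact: bounded_On_integrable.
Qed.

Lemma Rintegral_On_cst (c : R) : 'E (fun=> c) = c.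
Proof.
transitivity (c * fine (mu On)); last by case: Hmu => -> _; rewrite /= mulr1.
by apply: Rintegral_cst; exact: measurable_On.
Qed.

(** By invariance [f] and its rotated copy have equal means, so integrating the expansion leaves
    [s * |E g| <= C * s ^+ 2]; divide by [s] and let [s] tend to 0. *)
Lemma Rintegral_lie i j f g : i != j -> lie i j f g -> 'E g = 0.
Proof.
move=> ij [bf bg [C C0 hC]]; have mO := @measurable_On R n.
suff le0 : forall s, 0 < s <= 1 -> `|'E g| <= C * s.
  apply/eqP; rewrite -normr_le0; apply/ler_addgt0Pr => e e0; rewrite add0r.
  (* This gives [C * s <= e]; the [+ 1] keeps the denominator positive when [C = 0]. *)
  pose s := Num.min 1 (e / (C + 1)).
  have s01 : 0 < s <= 1.
    by rewrite lt_min ltr01 divr_gt0 ?ge_min ?lexx // ltr_wpDl.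
  have C1 : 0 < C + 1 by rewrite ltr_wpDl.
  rewrite (le_trans (le0 _ s01)) //.
  have : s <= e / (C + 1) by rewrite ge_min lexx orbT.
  rewrite ler_pdivlMr //; case/andP: s01 => s0 _; nra.
move=> s /andP[s0 s1]; have s01 : 0 <= s <= 1 by rewrite (ltW s0).
have RO := On_rot ij s01.
have bfR : bounded_On (fun M => f (rot_mx i j s *m M)).
  case: bf => mf [D D0 fD]; split.
    exact: (measurableT_comp mf (measurable_mulmx _)).
  by exists D => // M MO; apply: fD; exact: On_mulmx.
pose r M := f (rot_mx i j s *m M) - f M - s * g M.
have bsg : bounded_On (fun M => s * g M).
  by apply: bounded_OnM => //; exact: bounded_On_cst.
have bd : bounded_On (fun M => f (rot_mx i j s *m M) - f M).
  by apply: bounded_OnD => //; exact: bounded_OnN.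
have br : bounded_On r by apply: bounded_OnD => //; exact: bounded_OnN.
have Er : 'E r = - (s * 'E g).
  rewrite RintegralB //; [|exact: bounded_On_integrable..].
  rewrite RintegralB //; [|exact: bounded_On_integrable..].
  rewrite (Rintegral_On_mulmx bf RO) subrr sub0r RintegralZl //.
  exact: bounded_On_integrable.
have := le_normr_Rintegral mO (bounded_On_integrable br).
rewrite Er normrN normrM (gtr0_norm s0) => h.
rewrite -(ler_pM2l s0) (le_trans h) //.
have -> : s * (C * s) = 'E (fun=> C * s ^+ 2).
  by rewrite Rintegral_On_cst mulrCA expr2.
apply: le_Rintegral => //.
- apply: bounded_On_integrable; case: br => mr [D D0 rD]; split.
    exact: measurableT_comp.
  by exists D => // M MO; rewrite normr_id; exact: rD.
- by apply: bounded_On_integrable; exact: bounded_On_cst.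
- by move=> M MO; exact: hC.
Qed.

(** Boundedness is asked for members of [r] only, because [grad] controls [h j] only for
    [j != i]. *)
Lemma Rintegral_sum_On (I : eqType) (r : seq I) (F : I -> MX R n -> R) :
  (forall m, m \in r -> bounded_On (F m)) ->
  'E (fun M => \sum_(m <- r) F m M) = \sum_(m <- r) 'E (F m).
Proof.
elim: r => [|m r ih] bF.
  under eq_Rintegral do rewrite big_nil.
  by rewrite big_nil Rintegral_On_cst.
under eq_Rintegral do rewrite big_cons.
rewrite big_cons RintegralD.
- rewrite ih // => p pr; apply: bF; by rewrite inE pr orbT.
- exact: measurable_On.
- by apply: bounded_On_integrable; apply: bF; rewrite mem_head.
apply: bounded_On_integrable.
elim: r bF {ih} => [|p r ih] bF.
  by under eq_fun do rewrite big_nil; exact: bounded_On_cst.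
under eq_fun do rewrite big_cons; apply: bounded_OnD.
  by apply: bF; rewrite !inE eqxx orbT.
by apply: ih => q; rewrite inE => /orP[/eqP->|qr]; apply: bF;
  rewrite !inE ?eqxx // qr !orbT.
Qed.

Lemma Rintegral_On_lin (c d : R) f g : bounded_On f -> bounded_On g ->
  'E (fun M => c * f M + d * g M) = c * 'E f + d * 'E g.
Proof.
move=> bf bg; have mO := @measurable_On R n.
have bc (e : R) p : bounded_On p -> bounded_On (fun M => e * p M).
  by apply: bounded_OnM; exact: bounded_On_cst.
rewrite RintegralD //; [|exact/bounded_On_integrable/bc..].
by rewrite !RintegralZl //; exact: bounded_On_integrable.
Qed.

(* [d] is the sum over [j != i] of [M j k * L_ij f]. *)
Definition grad i k f d := exists2 h : 'I_n -> MX R n -> R,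
  (forall j, i != j -> lie i j f (h j)) &
  forall M, On M -> \sum_(j | i != j) M j k * h j M = d M.

(** If [a = i], then [L_ij] sends [M i l] to [M j l], and the sum is a column product without its
    term [j = i]. If [a != i], only [j = a] contributes, with derivative [- M i l]. *)
Lemma grad_entry i k a l : grad i k (fun M => (M : 'M[R]_n) a l)
  (fun M => ((a == i) && (k == l))%:R - M a k * M i l).
Proof.
exists (fun j M => (skew_mx i j *m M) a l) => [j ij|M MO]; first exact: lie_entry.
under eq_bigr do rewrite skew_mxE.
have [->|ai] := eqVneq a i.
  under eq_bigr => j ij do rewrite (negPf ij) mul0r subr0 mul1r.
  by rewrite /= -(On_colP k l MO) [in RHS](bigD1 i) //= addrAC subrr add0r;
    apply: eq_bigl => j; rewrite eq_sym.
rewrite /= (bigD1 a) /=; last by rewrite eq_sym.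
rewrite eqxx big1 ?addr0; first by rewrite mulr1n mulr0n; ring.
by move=> j /andP[_ ja]; rewrite [a == j]eq_sym (negPf ja) !mulr0n; ring.
Qed.

Lemma gradM i k f d g e : grad i k f d -> grad i k g e ->
  grad i k (fun M => f M * g M) (fun M => d M * g M + f M * e M).
Proof.
move=> [hf lf df] [hg lg dg].
exists (fun j M => hf j M * g M + f M * hg j M) => [j ij|M MO].
  by apply: lieM => //; [exact: lf|exact: lg].
rewrite -df // -dg // mulr_suml mulr_sumr -big_split /=.
by apply: eq_bigr => j _; ring.
Qed.

Lemma gradX i k f d m : grad i k f d ->
  grad i k (fun M => f M ^+ m) (fun M => m%:R * f M ^+ m.-1 * d M).
Proof.
move=> [hf lf df].
exists (fun j M => m%:R * f M ^+ m.-1 * hf j M) => [j ij|M MO].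
  by apply: lieX => //; exact: lf.
by rewrite -df // mulr_sumr; apply: eq_bigr => j _; ring.
Qed.

(* Sum [E (L_ij (M j k * g)) = 0] over [j != i], with [L_ij (M j k) = - M i k]. *)
Lemma divergence_On i k g d : grad i k g d ->
  (n.-1)%:R * 'E (fun M => M i k * g M) = 'E d.
Proof.
move=> [h gh hd]; have mO := @measurable_On R n.
(* The factor [n.-1] counts the rows [j != i]; it becomes a sum of equal terms, matched row by row
   with the right side. *)
have -> : n.-1 = #|[pred j | i != j]|.
  by rewrite (eq_card (B := predC1 i)) ?cardC1 ?card_ord // => j; rewrite !inE eq_sym.
rewrite (eq_Rintegral mu
  (g := fun M => \sum_(j <- enum [pred j | i != j]) M j k * h j M)); last first.
  by move=> M /set_mem MO; rewrite -hd // big_enum.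
have bMh j : i != j -> bounded_On (fun M => M j k * h j M).
  by move=> ij; apply: bounded_OnM; [exact: bounded_On_entry|by case: (gh _ ij)].
rewrite Rintegral_sum_On; last by move=> j; rewrite mem_enum; exact: bMh.
rewrite mulr_natl -sumr_const big_enum.
apply: eq_bigr => j ij.
have [bg _ _] := gh _ ij.
have := Rintegral_lie ij (lieM ij (lie_entry i j j k) (gh _ ij)).
have bMg : bounded_On (fun M => (M : 'M[R]_n) i k * g M).
  by apply: bounded_OnM => //; exact: bounded_On_entry.
move=> E0; suff /eqP : - 'E (fun M => M i k * g M) + 'E (fun M => M j k * h j M) = 0.
  by rewrite addrC subr_eq0 => /eqP.
rewrite -[RHS]E0 -mulN1r -['E (fun M => M j k * _)]mul1r -Rintegral_On_lin //; last exact: bMh.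
apply: eq_Rintegral => M _; rewrite skew_mxE eqxx [j == i]eq_sym (negPf ij).
by rewrite mulr1n mulr0n; ring.
Qed.
End HaarIntegral.

(** * Arithmetic of the shifted double factorial *)

Lemma pdf_gt0 m : (0 < pdf m)%N.
Proof.
rewrite /pdf; have [p] := ubnP m.-1; move: m.-1 => {}m.
elim: p m => // p ih [|[|m]] //= mp.
by rewrite muln_gt0 ih // -ltnS (leq_trans _ mp).
Qed.

Lemma pdfSS m : pdf m.+2 = (m.+1 * pdf m)%N.
Proof. by case: m. Qed.

(** The factors [(m-1)(m-3)...] and [m(m-2)...] together run through 1 to [m]. *)
Lemma pdf_fact m : (pdf m * pdf m.+1)%N = m`!.
Proof. by elim: m => // m ih; rewrite pdfSS factS -ih mulnCA [(pdf m * _)%N]mulnC. Qed.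

(** Absorbs the exponent [m.-1] left by differentiating a power, uniformly in [m]. *)
Lemma natr_expr_pred (R : comRingType) (x : R) m :
  m%:R * x ^+ m.-1 * x = m%:R * x ^+ m.
Proof. by case: m => [|m]; rewrite ?mul0r // -mulrA -exprSr. Qed.

(** * Recurrences and closed form for the moments *)

Section Moments.
Context {R : realType} {n : nat} (hn : (2 <= n)%N) (mu : probability (MX R n) R).
Hypothesis Hmu : is_haar_On mu.

Local Notation On := (@On R n).
Local Notation "''E' f" := (Rintegral mu On f) (at level 10, f at level 8).
Local Notation i0 := (oi0 hn).
Local Notation i1 := (oi1 hn).

Definition monomial a b c (M : MX R n) : R :=
  (M : 'M[R]_n) i0 i0 ^+ a * (M : 'M[R]_n) i1 i0 ^+ b * (M : 'M[R]_n) i0 i1 ^+ c.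

Definition moment a b c : R := 'E (monomial a b c).

Lemma bounded_OnX f m : bounded_On f -> bounded_On (fun M : MX R n => f M ^+ m).
Proof.
move=> bf; elim: m => [|m ih]; first exact: bounded_On_cst.
by under eq_fun do rewrite exprS; exact: bounded_OnM.
Qed.

Lemma bounded_On_monomial a b c : bounded_On (monomial a b c).
Proof.
by rewrite /monomial; repeat apply: bounded_OnM; apply: bounded_OnX;
  exact: bounded_On_entry.
Qed.

Lemma grad_monomial i k a b c d0 d1 d2 :
  grad i k (fun M : MX R n => (M : 'M[R]_n) i0 i0) d0 ->
  grad i k (fun M : MX R n => (M : 'M[R]_n) i1 i0) d1 ->
  grad i k (fun M : MX R n => (M : 'M[R]_n) i0 i1) d2 ->
  grad i k (monomial a b c) (fun M =>
    (a%:R * M i0 i0 ^+ a.-1 * d0 M * M i1 i0 ^+ b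
      + M i0 i0 ^+ a * (b%:R * M i1 i0 ^+ b.-1 * d1 M)) * M i0 i1 ^+ c
    + M i0 i0 ^+ a * M i1 i0 ^+ b * (c%:R * M i0 i1 ^+ c.-1 * d2 M)).
Proof. by move=> g0 g1 g2; apply: gradM; [apply: gradM|]; exact: gradX. Qed.

Let i10 : (i1 == i0) = false. Proof. by []. Qed.
Let i01 : (i0 == i1) = false. Proof. by []. Qed.
Let pn : n.-1%:R = n%:R - 1 :> R.
Proof. by rewrite -[in RHS](ltn_predK hn) -natr1 addrK. Qed.

(** Take [divergence_On] in row 0, column 0 with [monomial a.+1 b c]: each of the [a.+1 + b + c]
    factors contributes [- monomial a.+2 b c], and each factor [M i0 i0] also contributes
    [monomial a b c]. *)
Lemma moment_rec_a a b c :
  (a + b + c + n)%:R * moment a.+2 b c = a.+1%:R * moment a b c.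
Proof.
have := divergence_On Hmu (grad_monomial a.+1 b c
  (grad_entry i0 i0 i0 i0) (grad_entry i0 i0 i1 i0) (grad_entry i0 i0 i0 i1)).
rewrite !(eqxx, i10, i01) /= !(mulr0n, mulr1n) => H.
have E1 : 'E (fun M => M i0 i0 * monomial a.+1 b c M) = moment a.+2 b c.
  by apply: eq_Rintegral => M _; rewrite /monomial !exprS; ring.
have E2 := Rintegral_On_lin mu a.+1%:R (- (a.+1 + b + c)%:R)
  (bounded_On_monomial a b c) (bounded_On_monomial a.+2 b c).
suff : n.-1%:R * moment a.+2 b c =
    a.+1%:R * moment a b c + - (a.+1 + b + c)%:R * moment a.+2 b c.
  by rewrite pn !natrD -!(natr1 a); move: (moment _ _ _) (moment _ _ _) => x y; lra.
rewrite -[X in _ * X = _]E1 H -[RHS]E2; apply: eq_Rintegral => M _; rewrite /monomial /=.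
rewrite !natrD !mulrDl !mulNr !mulrDl.
have := natr_expr_pred (M i1 i0) b; have := natr_expr_pred (M i0 i1) c.
rewrite !exprS; set x := M i0 i0; set y := M i1 i0; set z := M i0 i1.
move=> hz hy.
have -> : b%:R * y ^+ b.-1 * (0 - y * x) = - (b%:R * y ^+ b) * x by rewrite -hy; ring.
have -> : c%:R * z ^+ c.-1 * (0 - x * z) = - (c%:R * z ^+ c) * x by rewrite -hz; ring.
ring.
Qed.

(** The same computation in row 0, column 1, with a pure power of [M i0 i1]. *)
Lemma moment_rec_c c :
  (c + n)%:R * moment 0 0 c.+2 = c.+1%:R * moment 0 0 c.
Proof.
have := divergence_On Hmu (grad_monomial 0 0 c.+1
  (grad_entry i0 i1 i0 i0) (grad_entry i0 i1 i1 i0) (grad_entry i0 i1 i0 i1)).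
rewrite !(eqxx, i10, i01) /= !(mulr0n, mulr1n) => H.
have E1 : 'E (fun M => M i0 i1 * monomial 0 0 c.+1 M) = moment 0 0 c.+2.
  by apply: eq_Rintegral => M _; rewrite /monomial !exprS; ring.
have E2 := Rintegral_On_lin mu c.+1%:R (- c.+1%:R)
  (bounded_On_monomial 0 0 c) (bounded_On_monomial 0 0 c.+2).
suff : n.-1%:R * moment 0 0 c.+2 =
    c.+1%:R * moment 0 0 c + - c.+1%:R * moment 0 0 c.+2.
  by rewrite pn !natrD -!(natr1 c); move: (moment _ _ _) (moment _ _ _) => x y; lra.
rewrite -[X in _ * X = _]E1 H -[RHS]E2; apply: eq_Rintegral => M _; rewrite /monomial /=.
by rewrite !exprS; ring.
Qed.

Lemma moment_rec_b b c :
  ((b + n.-1) * (b + c + n))%:R * moment 0 b.+2 c =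
  (b.+1 * (b + c + n.-1))%:R * moment 0 b c.
Proof.
pose J (M : MX R n) : R := c%:R * (M : 'M[R]_n) i0 i0 * (M : 'M[R]_n) i1 i0 ^+ b.+1
  * (M : 'M[R]_n) i0 i1 ^+ c.-1 * (M : 'M[R]_n) i1 i1.
have bJ : bounded_On J.
  by rewrite /J; repeat apply: bounded_OnM; try apply: bounded_OnX;
    solve [exact: bounded_On_entry | exact: bounded_On_cst].
(* Divergence in row 1, column 0; differentiating [M i0 i1] there gives [- M i0 i0 * M i1 i1], the
   source of [J]. *)
have HB : n.-1%:R * moment 0 b.+2 c
    = b.+1%:R * moment 0 b c - b.+1%:R * moment 0 b.+2 c - 'E J.
  have := divergence_On Hmu (grad_monomial 0 b.+1 c
    (grad_entry i1 i0 i0 i0) (grad_entry i1 i0 i1 i0) (grad_entry i1 i0 i0 i1)).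
  rewrite !(eqxx, i10, i01) /= !(mulr0n, mulr1n) => H.
  have E1 : 'E (fun M => M i1 i0 * monomial 0 b.+1 c M) = moment 0 b.+2 c.
    by apply: eq_Rintegral => M _; rewrite /monomial !exprS; ring.
  have bm := Rintegral_On_lin mu b.+1%:R (- b.+1%:R)
    (bounded_On_monomial 0 b c) (bounded_On_monomial 0 b.+2 c).
  (* Coefficients 1 are inserted to fit the two-term shape of [Rintegral_On_lin]. *)
  rewrite -mulNr -bm -[X in _ - X]mul1r -mulNr -[X in X + _]mul1r.
  rewrite -Rintegral_On_lin //; last first.
    by apply: bounded_OnD; apply: bounded_OnM;
      solve [exact: bounded_On_cst | exact: bounded_On_monomial].
  rewrite -[X in _ * X = _]E1 H; apply: eq_Rintegral => M _; rewrite /monomial /J /= !exprS; ring.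
(* A single rotation of rows 0 and 1 produces [J] again, which allows its elimination. *)
have HC : moment 0 b.+2 c - b.+1%:R * moment 2 b c + 'E J = 0.
  have ij : i0 != i1 by [].
  have := Rintegral_lie Hmu ij (lieM ij (lieM ij (lie_entry i0 i1 i0 i0)
    (lieX b.+1 ij (lie_entry i0 i1 i1 i0))) (lieX c ij (lie_entry i0 i1 i0 i1))).
  move=> H; rewrite -[RHS]H -mulNr -[X in X + _ + _]mul1r.
  rewrite -Rintegral_On_lin; [|exact: bounded_On_monomial..].
  rewrite -[X in X + _]mul1r -['E J]mul1r -Rintegral_On_lin //; last first.
    by apply: bounded_OnD; apply: bounded_OnM;
      solve [exact: bounded_On_cst | exact: bounded_On_monomial].
  apply: eq_Rintegral => M _; rewrite !skew_mxE !(eqxx, i10, i01) /monomial /J.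
  rewrite !(mulr0n, mulr1n) !exprS /=; ring.
have HA := moment_rec_a 0 b c.
rewrite !natrM !natrD pn -(natr1 b) in HA HB HC *.
move: ('E J) (moment _ _ _) (moment _ _ _) (moment _ _ _) HA HB HC => j x y z HA HB HC.
(* [HB] and [HC] without [j]; [HA] then expresses [z], the moment with exponent 2 on [M i0 i0],
   through [y]. *)
have xyz : (b%:R + (n%:R - 1)) * x = (b%:R + 1) * (y - z) by lra.
rewrite mulrAC xyz add0r mul1r in HA *.
transitivity ((b%:R + 1) * ((b%:R + c%:R + n%:R) * y - (b%:R + c%:R + n%:R) * z)).
  by ring.
by rewrite HA; ring.
Qed.

Lemma moment000 : moment 0 0 0 = 1.
Proof.
rewrite -[RHS](Rintegral_On_cst Hmu); apply: eq_Rintegral => M _.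
by rewrite /monomial !expr0 !mulr1.
Qed.

(** Division-free closed form, by induction on [a], then on [b] at [a = 0], then on [c] at
    [a = b = 0], as the recurrences require. The factor [pdf (b + c + k)] later cancels against the
    normalisation in [f_In]. *)
Lemma momentE k a b c : n = k.+2 -> ~~ odd a -> ~~ odd b -> ~~ odd c ->
  moment a b c * (pdf (b + k) * pdf (c + k) * pdf (a + b + c + k).+1)%:R =
  (k`! * pdf a * pdf b * pdf c * pdf (b + c + k))%:R.
Proof.
move=> nk.
(* Writing even exponents as doubles turns steps of two into ordinary induction. *)
have dbl m : ~~ odd m -> m = m./2.*2 by move=> /even_halfK.
move=> /dbl -> /dbl -> /dbl ->; move: (a./2) (b./2) (c./2) => {dbl}{}a {}b {}c.
elim: a => [|a]; last first.
  have := moment_rec_a a.*2 b.*2 c.*2; rewrite nk doubleS !addSn !addnS !pdfSS.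
  move: (moment _ _ _) (moment _ _ _) => x y xy ih.
  rewrite !natrM in ih *.
  transitivity (a.*2.+1%:R * (x * ((pdf (b.*2 + k))%:R * (pdf (c.*2 + k))%:R
    * (pdf (a.*2 + b.*2 + c.*2 + k).+1)%:R))).
    by rewrite [RHS]mulrA -xy; ring.
  by rewrite ih; ring.
elim: b => [|b]; last first.
  have := moment_rec_b b.*2 c.*2; rewrite nk /= doubleS !add0n !addSn !addnS !pdfSS.
  move: (moment _ _ _) (moment _ _ _) => x y; rewrite !natrM => xy ih.
  transitivity (b.*2.+1%:R * (b.*2 + c.*2 + k).+1%:R * 
    (x * ((pdf (b.*2 + k))%:R * (pdf (c.*2 + k))%:R
      * (pdf (b.*2 + c.*2 + k).+1)%:R))).
    by rewrite [RHS]mulrA -xy; ring.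
  by rewrite ih; ring.
elim: c => [|c]; last first.
  have := moment_rec_c c.*2; rewrite nk doubleS !add0n !addSn !addnS !pdfSS.
  move: (moment _ _ _) (moment _ _ _) => x y; rewrite !natrM => xy ih.
  transitivity (c.*2.+1%:R * (c.*2 + k).+1%:R * 
    (x * ((pdf k)%:R * (pdf (c.*2 + k))%:R * (pdf (c.*2 + k).+1)%:R))).
    by rewrite [RHS]mulrA [_ * x]mulrAC -xy; ring.
  by rewrite ih; ring.
by rewrite moment000 !add0n -pdf_fact mul1r (_ : pdf 0.*2 = 1%N) // !muln1 mulnAC.
Qed.

End Moments.

Theorem theorem7p3 (R : realType) (n : nat) (hn : (2 <= n)%N)
    (mu : probability (MX R n) R) (Hmu : is_haar_On mu)
    (a b c : nat) (ha : ~~ odd a) (hb : ~~ odd b) (hc : ~~ odd c) :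
  f_In hn mu a b c 0 =
    ((n - 2)`! * pdf (n - 2))%:R / (Pk (n - 1) a b c 0)%:R *
      ((Fk 0 a b c 0)%:R / (Fk (n - 2) a b c 0)%:R)
  /\
  f_In hn mu a b c 0 =
    ((n - 2)`! * pdf a * pdf b * pdf c)%:R /
      ((pdf (a + n - 2) * pdf (b + n - 2) * pdf (c + n - 2)
        * pdf (a + b + c + n - 1))%:R).
Proof.
have [k nk] : exists k, n = k.+2 by case: (n) hn => [|[|k]] // _; exists k.
have := momentE hn Hmu nk ha hb hc.
have -> : moment hn mu a b c = In_int hn mu a b c 0.
  have [mf _] := @bounded_On_monomial R n hn a b c.
  rewrite /moment -(Rintegral_On Hmu mf).
  by apply: eq_Rintegral => M _; rewrite /monomial expr0 mulr1 mulrAC.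
rewrite /f_In /Pk /Fk; move: (In_int _ _ _ _ _ _) => x.
(* With [n = k.+2] the truncated subtractions disappear. *)
rewrite nk -!addnBA // !subSS !subn0 !addn0 !addnS add0n (_ : pdf 0 = 1%N) //.
have pdf0 m : (pdf m)%:R != 0 :> R by rewrite pnatr_eq0 -lt0n pdf_gt0.
rewrite !natrM => /(canRL (mulfK _)) ->; last by rewrite !mulf_neq0.
(* In the first form [pdf k], the [d = 0] factor of [Fk (n - 2)], cancels the [pdf (n - 2)] of the
   numerator. *)
by split; field; rewrite !pdf0.
Qed.
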